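(* Consider the (not necessarily symmetric) Cournot duopoly game with uncertainty: for $i=1,2$ and $j=3-i$, player $i$ chooses $x_i\in[0,1/2]$, has type $\theta_i\in\Theta_i=[\alpha_i,\beta_i]$ with $0\le\alpha_i<\beta_i\le1/2$, and has reward $u_i(x,\theta_i)=x_i(1-x_1-x_2)^+-\theta_ix_i$. Then, in the attitude game, both players cannot simultaneously have pessimism as their dominant attitude.
   Context: Setting. Player $i$ knows $\theta_i$ but only knows that $\theta_j\in\Theta_j$; this is common knowledge. The strategy space of each player is $X_{i,o}=[0,1/2]$, and $y^+=\max\{y,0\}$. Attitudes. Player $i$ has attitude $\pi_i$ ($1$ = optimism, $0$ = pessimism). If player $i$ believes $x_j\in X_j$, she maximizes over $x_i\in X_{i,o}$ the quantity $$f_i(x_i,X_j,\theta_i,\pi_i)=\pi_i\max_{x_j\in X_j}u_i(x,\theta_i)+(1-\pi_i)\min_{x_j\in X_j}u_i(x,\theta_i).$$ Let $r_i(X_j,\theta_i;\pi_i)$ be the set of maximizers and $\psi_i(X_j;\pi_i)=\bigcup_{\theta_i\in\Theta_i}r_i(X_j,\theta_i;\pi_i)$. A pair of sets $(X_1,X_2)$ is an uncertainty equilibrium for attitudes $\pi=(\pi_1,\pi_2)$ if $X_i=\psi_i(X_j;\pi_i)$ for $i=1,2$, $j=3-i$. In this game the uncertainty equilibrium $(X_1,X_2)$ for given $\pi$ exists and is unique, and player $i$ plays the unique element $x_i(\theta_i,\pi)$ of $r_i(X_j,\theta_i;\pi_i)$. The actual reward of player $i$ is $U_i(\pi)=u_i(x_i(\theta_i,\pi),x_j(\theta_j,\pi),\theta_i)$.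 Attitude game. In the first stage the players choose $(\pi_1,\pi_2)\in\{0,1\}^2$; in the second stage they play the game with these attitudes and get the rewards $U_i(\pi)$. An attitude $\pi_i^*$ of player $i$ (of type $\theta_i$) is dominant if for every $\pi_j\in\{0,1\}$ and every $\theta_j\in\Theta_j$ one has $U_i(\pi_i^*,\pi_j)\ge U_i(\pi_i,\pi_j)$ for all $\pi_i\in\{0,1\}$ (where $U_i(\pi_i,\pi_j)$ denotes the reward of player $i$ when she has attitude $\pi_i$ and the opponent $\pi_j$). *)

(* Defs.v *)
From HB Require Import structures.
From mathcomp Require Import all_boot all_order all_algebra.
From mathcomp Require Import all_classical all_reals.

Set Implicit Arguments.
Unset Strict Implicit.
Unset Printing Implicit Defensive.

Import Order.TTheory GRing.Theory Num.Theory.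
Local Open Scope classical_set_scope.
Local Open Scope ring_scope.

(* The two players are the elements [ord0] and [ord_max] of ['I_2], and
   quantities attached to the players (type bounds, types, attitudes, actions,
   belief sets) are families indexed by ['I_2]. *)

Section AttitudeGame.
Variable R : realType.
Implicit Types (i : 'I_2) (a b t p : R) (A X : set R).

Definition opponent i : 'I_2 := rev_ord i.

(* The family with value [a] at player [i] and [b] at the opponent of [i]. *)
Definition profile i a b : 'I_2 -> R := fun k => if k == i then a else b.

Definition strategies : set R := [set` `[0, 1 / 2]%R].

Definition pessimism : R := 0.
Definition optimism : R := 1.
Definition attitudes : set R := [set pessimism; optimism].

Definition reward i (x : 'I_2 -> R) t : R :=
  x i * Num.max (1 - x ord0 - x ord_max) 0 - t * x i.

(* Attained extrema, with default value 0 if the extremum is not attained; the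
   default plays no role at an equilibrium, whose component sets are nonempty
   compact intervals. *)
Definition maximum A : R := xget 0 [set m | A m /\ ubound A m].
Definition minimum A : R := xget 0 [set m | A m /\ lbound A m].

Definition evaluation i a X t p : R :=
  p * maximum [set reward i (profile i a b) t | b in X]
  + (1 - p) * minimum [set reward i (profile i a b) t | b in X].

Definition best_response i X t p : set R :=
  [set a | strategies a /\
     forall a', strategies a' -> evaluation i a' X t p <= evaluation i a X t p].

Variables alpha beta : 'I_2 -> R.

Definition types i : set R := [set` `[alpha i, beta i]%R].

Definition response_set i X p : set R :=
  \bigcup_(t in types i) best_response i X t p.

Definition uncertainty_equilibrium (p : 'I_2 -> R) (X : 'I_2 -> set R) : Prop :=
  forall i, X i = response_set i (X (opponent i)) (p i).

(* Under [0 <= alpha i < beta i <= 1 / 2], the equilibrium for attitudes in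
   {0, 1} and the best response to it exist and are unique, so that both uses of
   [xget] below are definite descriptions. *)
Definition equilibrium_sets (p : 'I_2 -> R) : 'I_2 -> set R :=
  xget (fun=> set0) (uncertainty_equilibrium p).

Definition equilibrium_action i t (p : 'I_2 -> R) : R :=
  xget 0 (best_response i (equilibrium_sets p (opponent i)) t (p i)).

Definition actual_reward i (theta p : 'I_2 -> R) : R :=
  reward i (fun k => equilibrium_action k (theta k) p) (theta i).

(* [t] is the actual type of player [i]; the type of the opponent is universally
   quantified. *)
Definition dominant i t p : Prop :=
  attitudes p /\
  forall pj tj, attitudes pj -> types (opponent i) tj ->
  forall q, attitudes q ->
    actual_reward i (profile i t tj) (profile i q pj)
      <= actual_reward i (profile i t tj) (profile i p pj).

End AttitudeGame.

(* Main.v *)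
(* Facing a belief X_j inside [0, 1/2], a pessimist plays against max X_j and an
   optimist against min X_j, so a player of type t facing the relevant endpoint c
   plays (1 - c - t) / 2, and the equilibrium reduces to a linear system for the
   two endpoints. If player i switches from pessimism to optimism, then, with
   D = beta_j - alpha_j, her action x_i grows by D / 3 and that of the opponent
   drops by D / 6. When the opponent has type beta_j this changes the reward of i
   by D / 3 * (x_i / 2 + D / 3) > 0. So pessimism is dominant for neither
   player. *)
Require Import Defs.
From HB Require Import structures.
From mathcomp Require Import all_boot all_order all_algebra.
From mathcomp Require Import all_classical all_reals.
From mathcomp Require Import ring lra.

Set Implicit Arguments.
Unset Strict Implicit.
Unset Printing Implicit Defensive.

Import Order.TTheory GRing.Theory Num.Theory.
Local Open Scope classical_set_scope.
Local Open Scope ring_scope.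

(** * Rewards on the strategy space and attained extrema *)

(** Two actions of at most 1/2 sum to at most 1, so the positive part is inactive. *)
Lemma reward_profile (R : realType) (i : 'I_2) (x : 'I_2 -> R) (t : R) :
  strategies (x i) -> strategies (x (opponent i)) ->
  reward i x t = x i * (1 - x i - x (opponent i) - t).
Proof.
rewrite /strategies /= !in_itv /= => /andP[_ hi] /andP[_ hj].
have -> : reward i x t =
    x i * Num.max (1 - x i - x (opponent i)) 0 - t * x i.
  rewrite /reward; case: i hi hj => [[|[|//]] hk] _ _.
    have -> : Ordinal hk = ord0 by apply: val_inj.
    by have -> : opponent ord0 = ord_max by apply: val_inj.
  have -> : Ordinal hk = ord_max by apply: val_inj.
  have -> : opponent ord_max = ord0 by apply: val_inj.
  by rewrite (addrAC 1).
have /max_idPl -> : 0 <= 1 - x i - x (opponent i) by lra.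
ring.
Qed.

Lemma opponentK : involutive opponent.
Proof. exact: rev_ordK. Qed.

Lemma opponent_neq (i : 'I_2) : (opponent i == i) = false.
Proof. by case: i => [[|[|//]] hk]. Qed.

Lemma profile_self (R : realType) (i : 'I_2) (a b : R) : profile i a b i = a.
Proof. by rewrite /profile eqxx. Qed.

Lemma profile_opponent (R : realType) (i : 'I_2) (a b : R) :
  profile i a b (opponent i) = b.
Proof. by rewrite /profile opponent_neq. Qed.

Lemma maximumE (R : realType) (A : set R) (m : R) :
  A m -> ubound A m -> maximum A = m.
Proof.
move=> Am ubm; apply: xget_unique => // m' [Am' ubm'].
by apply/eqP; rewrite eq_le ubm' // ubm.
Qed.

Lemma minimumE (R : realType) (A : set R) (m : R) :
  A m -> lbound A m -> minimum A = m.
Proof.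
move=> Am lbm; apply: xget_unique => // m' [Am' lbm'].
by apply/eqP; rewrite eq_le lbm' // lbm.
Qed.

(* [c] is the point of the belief [X] against which a player with attitude [p]
   optimizes. *)
Definition decisive (R : realType) (p : R) (X : set R) (c : R) : Prop :=
  X c /\ if p == pessimism R then ubound X c else lbound X c.

(** * Evaluation and best response against a belief *)

Lemma reward_against (R : realType) (i : 'I_2) (a b t : R) :
  strategies a -> strategies b ->
  reward i (profile i a b) t = a * (1 - a - b - t).
Proof.
by move=> sa sb; rewrite reward_profile ?profile_self ?profile_opponent.
Qed.

(** For [a >= 0] the reward is nonincreasing in the opponent's action, so its minimum over [X] is
    attained at the largest point and its maximum at the smallest. *)
Lemma evaluation_decisive (R : realType) (i : 'I_2) (a c t p : R) (X : set R) :
  attitudes p -> X `<=` @strategies R -> decisive p X c -> strategies a ->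
  evaluation i a X t p = a * (1 - a - c - t).
Proof.
move=> ap sX [Xc dc] sa.
have a0 : 0 <= a by move: sa; rewrite /strategies /= in_itv /= => /andP[].
rewrite -(reward_against i t sa (sX _ Xc)) /evaluation.
case: ap dc => ->; rewrite /pessimism /optimism ?eqxx ?oner_eq0 => dc.
  rewrite mul0r add0r subr0 mul1r; apply: minimumE; first by exists c.
  move=> _ [b Xb <-]; rewrite !reward_against //; do ?exact: sX.
  by apply: ler_wpM2l => //; have := dc _ Xb; lra.
rewrite subrr mul0r addr0 mul1r; apply: maximumE; first by exists c.
move=> _ [b Xb <-]; rewrite !reward_against //; do ?exact: sX.
by apply: ler_wpM2l => //; have := dc _ Xb; lra.
Qed.

Lemma xget_default_or (R : realType) (A : set R) : A (xget 0 A) \/ xget 0 A = 0.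
Proof. by case: xgetP => [x _ Ax|_]; [left|right]. Qed.

(* Without a decisive point the extremum is attained only for [a = 0], where the
   reward vanishes. *)
Lemma evaluation_indecisive (R : realType) (i : 'I_2) (a t p : R) (X : set R) :
  attitudes p -> X `<=` @strategies R -> ~ (exists c, decisive p X c) ->
  strategies a -> evaluation i a X t p = 0.
Proof.
move=> ap sX nd sa.
have a0 : 0 <= a by move: sa; rewrite /strategies /= in_itv /= => /andP[].
rewrite /evaluation; case: ap nd => -> nd.
  rewrite /pessimism mul0r add0r subr0 mul1r /minimum.
  set A := (X in xget 0 X); case: (xget_default_or A) => // -[[c Xc <-] lb].
  rewrite reward_against //; last exact: sX.
  have [->|an0] := eqVneq a 0; first by rewrite mul0r.
  have a_gt0 : 0 < a by rewrite lt_neqAle eq_sym an0.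
  case: nd; exists c; split=> //; rewrite eqxx => b Xb.
  have := lb _ (ex_intro2 _ _ b Xb erefl).
  rewrite !reward_against //; do ?exact: sX.
  by rewrite ler_pM2l //; lra.
rewrite /optimism subrr mul0r addr0 mul1r /maximum.
set A := (X in xget 0 X); case: (xget_default_or A) => // -[[c Xc <-] ub].
rewrite reward_against //; last exact: sX.
have [->|an0] := eqVneq a 0; first by rewrite mul0r.
have a_gt0 : 0 < a by rewrite lt_neqAle eq_sym an0.
case: nd; exists c; split=> //; rewrite /optimism /pessimism oner_eq0 => b Xb.
have := ub _ (ex_intro2 _ _ b Xb erefl).
rewrite !reward_against //; do ?exact: sX.
by rewrite ler_pM2l //; lra.
Qed.

(** The evaluation is a concave quadratic in [a] with vertex [r = (1 - c - t) / 2], which lies in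
    [0, 1/2]; the value at [a] falls short of the value at [r] by exactly [(a - r)^2]. *)
Lemma best_response_decisive (R : realType) (i : 'I_2) (c t p : R) (X : set R) :
  attitudes p -> X `<=` @strategies R -> decisive p X c -> 0 <= t <= 1 / 2 ->
  best_response i X t p = [set (1 - c - t) / 2].
Proof.
move=> ap sX dc /andP[t0 t1].
have /andP[c0 c1] : 0 <= c <= 1 / 2.
  by have := sX _ dc.1; rewrite /strategies /= in_itv.
have sr : strategies ((1 - c - t) / 2).
  by rewrite /strategies /= in_itv /=; apply/andP; split; lra.
apply/seteqP; split => a /=.
  move=> [sa /(_ _ sr)]; rewrite !(evaluation_decisive i t ap sX dc) // => le.
  apply/eqP; rewrite -subr_eq0 -sqrf_eq0 eq_le sqr_ge0 andbT.
  by nra.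
move=> ->; split=> // a' sa'.
rewrite !(evaluation_decisive i t ap sX dc) //.
by have := sqr_ge0 (a' - (1 - c - t) / 2); nra.
Qed.

(** * Response sets *)

Section Equilibrium.
Variables (R : realType) (alpha beta : 'I_2 -> R).
Hypothesis alpha_ge0 : forall i, 0 <= alpha i.
Hypothesis alpha_lt_beta : forall i, alpha i < beta i.
Hypothesis beta_le_half : forall i, beta i <= 1 / 2.

Lemma type_bounds i t : types alpha beta i t -> 0 <= t <= 1 / 2.
Proof.
rewrite /types /= in_itv /= => /andP[t0 t1].
by have := alpha_ge0 i; have := beta_le_half i; lra.
Qed.

Lemma response_set_decisive i c p X :
  attitudes p -> X `<=` @strategies R -> decisive p X c ->
  response_set alpha beta i X p =
    [set` `[(1 - c - beta i) / 2, (1 - c - alpha i) / 2]%R].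
Proof.
move=> ap sX dc; apply/seteqP; split => a.
  move=> [t ti]; rewrite (best_response_decisive i ap sX dc (type_bounds ti)).
  move=> /= ->; move: ti; rewrite /types /= !in_itv /= => /andP[t0 t1].
  by apply/andP; split; lra.
rewrite /= in_itv /= => /andP[a0 a1].
(* The witness solves [(1 - c - t) / 2 = a] for the type [t]. *)
have ti : types alpha beta i (1 - c - 2 * a).
  by rewrite /types /= in_itv /=; apply/andP; split; lra.
exists (1 - c - 2 * a) => //.
by rewrite (best_response_decisive i ap sX dc (type_bounds ti)) /=; lra.
Qed.

(** Every evaluation takes the default value 0, so all strategies tie. Uniqueness of the equilibrium
    has to rule out this degenerate case. *)
Lemma response_set_indecisive i p X :
  attitudes p -> X `<=` @strategies R -> ~ (exists c, decisive p X c) ->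
  response_set alpha beta i X p = @strategies R.
Proof.
move=> ap sX nd; apply/seteqP; split => a; first by move=> [t _ []].
move=> sa; exists (alpha i).
  by rewrite /types /= in_itv /= lexx ltW.
by split=> // a' sa'; rewrite !evaluation_indecisive.
Qed.

Lemma decisive_itv p (l h : R) : l <= h ->
  decisive p [set` `[l, h]%R] (if p == pessimism R then h else l).
Proof.
move=> lh; rewrite /decisive; case: ifP => _; split=> /=; rewrite ?in_itv /= ?lexx ?lh //.
  by move=> b /=; rewrite in_itv => /andP[].
by move=> b /=; rewrite in_itv => /andP[].
Qed.

Lemma decisive_unique p (X : set R) c c' :
  decisive p X c -> decisive p X c' -> c = c'.
Proof.
rewrite /decisive; case: ifP => _ [Xc b] [Xc' b'];
  by apply/eqP; rewrite eq_le ?b ?b'.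
Qed.

(* The type of player [k] that the opponent has in mind: a pessimist minds the
   largest action, hence the smallest cost, and an optimist the reverse. *)
Definition decisive_type (p : 'I_2 -> R) k : R :=
  if p (opponent k) == pessimism R then alpha k else beta k.

(* The solution of [c k = (1 - c (opponent k) - decisive_type p k) / 2]. *)
Definition decisive_action (p : 'I_2 -> R) k : R :=
  (1 + decisive_type p (opponent k) - 2 * decisive_type p k) / 3.

Definition equilibrium_itv (p : 'I_2 -> R) k : set R :=
  [set` `[(1 - decisive_action p (opponent k) - beta k) / 2,
          (1 - decisive_action p (opponent k) - alpha k) / 2]%R].

(** * Existence and uniqueness of the equilibrium *)

Lemma decisive_type_bounds p k : 0 <= decisive_type p k <= 1 / 2.
Proof.
have := alpha_ge0 k; have := beta_le_half k; have := alpha_lt_beta k.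
by rewrite /decisive_type; case: ifP => _; lra.
Qed.

(** Over costs in [0, 1/2] the formula ranges exactly between 0 and 1/2, so the solution of the
    linear system is never truncated. *)
Lemma decisive_action_bounds p k : 0 <= decisive_action p k <= 1 / 2.
Proof.
have := decisive_type_bounds p k; have := decisive_type_bounds p (opponent k).
by rewrite /decisive_action; lra.
Qed.

Lemma equilibrium_itv_strategies p k : equilibrium_itv p k `<=` @strategies R.
Proof.
move=> a; rewrite /equilibrium_itv /strategies /= !in_itv /=.
have := decisive_action_bounds p (opponent k).
have := alpha_ge0 k; have := beta_le_half k; have := alpha_lt_beta k.
by lra.
Qed.

Lemma decisive_actionP p k :
  decisive (p (opponent k)) (equilibrium_itv p k) (decisive_action p k).
Proof.
have lh : (1 - decisive_action p (opponent k) - beta k) / 2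
       <= (1 - decisive_action p (opponent k) - alpha k) / 2.
  by have := alpha_lt_beta k; lra.
have := decisive_itv (p (opponent k)) lh.
congr decisive.
rewrite /decisive_action opponentK; move: (decisive_type p (opponent k)) => tau.
by rewrite /decisive_type; case: (_ == _); lra.
Qed.

Lemma equilibrium_itvP p : (forall k, attitudes (p k)) ->
  uncertainty_equilibrium alpha beta p (equilibrium_itv p).
Proof.
move=> ap k; rewrite (@response_set_decisive _ (decisive_action p (opponent k))) //.
  exact: equilibrium_itv_strategies.
by have := decisive_actionP p (opponent k); rewrite opponentK.
Qed.

Lemma uncertainty_equilibrium_unique p X : (forall k, attitudes (p k)) ->
  uncertainty_equilibrium alpha beta p X -> X = equilibrium_itv p.
Proof.
move=> ap eqX.
have sX k : X k `<=` @strategies R by rewrite eqX => a [t _ []].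
have has_decisive k : exists c, decisive (p (opponent k)) (X k) c.
  (* If [X k] had no decisive point, the opponent's response set would be all of [0, 1/2]. That
     interval contains both its endpoints, so [X k], as a response to it, would be a closed interval
     and have a decisive point after all. *)
  apply: contrapT => nd.
  have Xo : X (opponent k) = @strategies R.
    by rewrite eqX opponentK response_set_indecisive.
  have half_ge0 : 0 <= 1 / 2 :> R by lra.
  have dk : decisive (p k) (X (opponent k)) (if p k == pessimism R then 1 / 2 else 0).
    by rewrite Xo; exact: decisive_itv.
  case: nd; rewrite eqX (response_set_decisive k (ap k) (sX _) dk).
  eexists; apply: decisive_itv.
  by have := alpha_lt_beta k; lra.
have [c dc] : exists c : 'I_2 -> R, forall k, decisive (p (opponent k)) (X k) (c k).
  by exists (fun k => projT1 (cid (has_decisive k))) => k; case: cid.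
have XE k : X k = [set` `[(1 - c (opponent k) - beta k) / 2,
                          (1 - c (opponent k) - alpha k) / 2]%R].
  rewrite eqX (@response_set_decisive _ (c (opponent k))) //.
  by have := dc (opponent k); rewrite opponentK.
have cE k : c k = (1 - c (opponent k) - decisive_type p k) / 2.
  have lh : (1 - c (opponent k) - beta k) / 2 <= (1 - c (opponent k) - alpha k) / 2.
    by have := alpha_lt_beta k; lra.
  have := decisive_itv (p (opponent k)) lh; rewrite -XE => /(decisive_unique (dc k)) ->.
  by rewrite /decisive_type; case: ifP.
(* The equations [cE] for [k] and its opponent form a nonsingular 2 by 2 linear system. *)
have cF k : c k = decisive_action p k.
  have := cE k; have := cE (opponent k); rewrite opponentK /decisive_action; lra.
by apply/funext => k; rewrite XE cF.
Qed.

Lemma equilibrium_setsE p : (forall k, attitudes (p k)) ->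
  equilibrium_sets alpha beta p = equilibrium_itv p.
Proof.
move=> ap; apply: xget_unique; first exact: equilibrium_itvP.
by move=> X /uncertainty_equilibrium_unique; apply.
Qed.

(** * Equilibrium rewards and the gain from optimism *)

Lemma equilibrium_actionE i t p : (forall k, attitudes (p k)) ->
  types alpha beta i t ->
  equilibrium_action alpha beta i t p =
    (1 - decisive_action p (opponent i) - t) / 2.
Proof.
move=> ap ti; rewrite /equilibrium_action equilibrium_setsE //.
have dk := decisive_actionP p (opponent i); rewrite opponentK in dk.
rewrite (best_response_decisive i (ap i) _ dk (type_bounds ti)); last first.
  exact: equilibrium_itv_strategies.
by apply: xget_unique => // y.
Qed.

Lemma actual_rewardE i theta p : (forall k, attitudes (p k)) ->
  (forall k, types alpha beta k (theta k)) ->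
  let x k := (1 - decisive_action p (opponent k) - theta k) / 2 in
  actual_reward alpha beta i theta p =
    x i * (1 - x i - x (opponent i) - theta i).
Proof.
move=> ap ti x.
have xE k : equilibrium_action alpha beta k (theta k) p = x k.
  exact: equilibrium_actionE.
have sx k : strategies (x k).
  rewrite /strategies /= in_itv /= /x.
  have := decisive_action_bounds p (opponent k); have := type_bounds (ti k); lra.
by rewrite /actual_reward reward_profile ?xE.
Qed.

Lemma pessimism_not_dominant i t : types alpha beta i t ->
  ~ dominant alpha beta i t (pessimism R).
Proof.
move=> ti [_ dom].
pose j := opponent i.
have tj : types alpha beta j (beta j) by rewrite /types /= in_itv /= lexx ltW.
have app : attitudes (pessimism R) by left.
have apo : attitudes (optimism R) by right.
have profileP (P : 'I_2 -> R -> Prop) a b :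
    P i a -> P j b -> forall k, P k (profile i a b k).
  move=> Pa Pb k; rewrite /profile; case: eqVneq => [-> //|ki].
  suff -> : k = j by [].
  by apply/val_inj; case: i k ki {ti dom tj Pa Pb} @j => [[|[|//]] ?] [[|[|//]] ?].
(* The switch to optimism is tested against a pessimistic opponent of the highest cost [beta j]. *)
have := dom _ _ app tj _ apo.
have typ := profileP (types alpha beta) _ _ ti tj.
have att q : attitudes q -> forall k, attitudes (profile i q (pessimism R) k).
  by move=> aq; apply: (profileP (fun=> @attitudes R)).
rewrite !actual_rewardE //; try exact: att.
rewrite /decisive_action !opponentK /decisive_type !opponentK.
rewrite !profile_self !profile_opponent eqxx /optimism /pessimism oner_eq0 -/j.
have := type_bounds ti; have := alpha_lt_beta j; have := alpha_ge0 i.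
have := alpha_ge0 j; have := beta_le_half j; have := beta_le_half i.
have := alpha_lt_beta i.
move: (alpha i) (alpha j) (beta i) (beta j) => ai aj bi bj.
move=> h1 h2 h3 h4 h5 h6 /andP[h7 h8].
apply/negP; rewrite -ltNge -subr_gt0.
(* This is the action of player [i] under pessimism. *)
set x := (1 - (1 + ai - 2 * aj) / 3 - t) / 2.
have x_ge0 : 0 <= x by rewrite /x; lra.
(* Put [D = bj - aj]. The opponent of type [bj] produces [D / 2] less than the amount [x] responds
   to, so the pessimist's margin is [x + D / 2]. The switch raises the action by [D / 3] and lowers
   the margin by [D / 6], and the change of the product is this expression. *)
have gain_gt0 : 0 < (bj - aj) / 3 * (x / 2 + (bj - aj) / 3).
  by apply: mulr_gt0; lra.
by rewrite /x in gain_gt0 *; lra.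
Qed.

End Equilibrium.

Theorem theorem7 (R : realType) (alpha beta : 'I_2 -> R)
    (alpha_ge0 : forall i, 0 <= alpha i)
    (alpha_lt_beta : forall i, alpha i < beta i)
    (beta_le_half : forall i, beta i <= 1 / 2)
    (theta : 'I_2 -> R)
    (theta_type : forall i, types alpha beta i (theta i)) :
  ~ (dominant alpha beta ord0 (theta ord0) (pessimism R)
     /\ dominant alpha beta ord_max (theta ord_max) (pessimism R)).
Proof. by move=> [/pessimism_not_dominant + _]; apply. Qed.
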